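(* Let $q=p^e$ be an odd prime power, $d=q-1$, $K=\mathbb F_q(t)$, and $c\in K^\times$. Let $\rho_t^c(x)=tx+cx^q$ be the twisted Carlitz module corresponding to $f_c(x)=cx^{q-1}+t$. Suppose that the first arboreal level of $f_c$ is maximal, i.e. $$\operatorname{Gal}(K(f_c^{-1}(0))/K)\cong C_d.$$ Then the $t$-adic Galois representation attached to $\rho_t^c$ is surjective, i.e. $\operatorname{def}(\Delta,t^m)=1$ for every $m\ge 1$, where $\Delta\in\mathbb F_q[t]$ is the $d$-power-free representative of the class of $c$ in $K^\times/(K^\times)^d$. In other words, arboreal maximality of $f_c$ implies $t$-adic surjectivity of the associated twisted Carlitz module $\rho_t^c$.
   Context: $C_d$ is the cyclic group of order $d$, and $K(f_c^{-1}(0))$ is the extension of $K$ generated by all roots of $f_c$. For $\Delta\in K^\times$, the twisted Carlitz module $\rho^{\Delta}$ is the rank-one Drinfeld $\mathbb F_q[t]$-module over $K$ determined by $\rho_t^{\Delta}(x)=tx+\Delta x^q$; that is, $N\mapsto\rho_N^{\Delta}(x)$ is the $\mathbb F_q$-algebra homomorphism from $\mathbb F_q[t]$ to the ring of $\mathbb F_q$-linear polynomials over $K$ (under addition and composition) sending $t$ to $\rho_t^\Delta$. For nonconstant $N\in\mathbb F_q[t]$, the set of roots of $\rho^{\Delta}_N(x)$ in $K^{\mathrm{sep}}$ is a free $\mathbb F_q[t]/(N)$-module of rank one, so the Galois action on it gives the mod-$N$ representation $\operatorname{Gal}(K^{\mathrm{sep}}/K)\to(\mathbb F_q[t]/(N))^\times$.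 The defect $\operatorname{def}(\Delta,N)$ is the index of its image in $(\mathbb F_q[t]/(N))^\times$. The $t$-adic representation is the inverse limit over $m\ge 1$ of the mod-$t^m$ representations, with values in $\mathbb F_q[[t]]^\times$. The $K$-isomorphism class of $\rho^c$ depends only on the class of $c$ in $K^\times/(K^\times)^d$. A polynomial $\Delta\in\mathbb F_q[t]\setminus\{0\}$ is $d$-power-free if every monic irreducible polynomial divides it with exponent $<d$. Arboreal maximality of $f_c$ means that for every $n\ge 1$ the Galois group over $K$ of the $n$-th iterate $f_c^{\circ n}$ is isomorphic to the $n$-fold iterated wreath product $C_d\wr\cdots\wr C_d$ (acting on the rooted $d$-ary tree); for $n=1$ this says the group is $C_d$. *)

(* Defs.v *)
From mathcomp Require Import all_boot all_order all_algebra all_fingroup.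
From mathcomp Require Import all_solvable all_field.
From mathcomp Require Import boolp.

Set Implicit Arguments.
Unset Strict Implicit.
Unset Printing Implicit Defensive.

Import GRing.Theory.
Local Open Scope ring_scope.

Notation ratfun F := {fraction {poly F}}.

Section FunctionField.
Variable F : finFieldType.

Definition tvar : ratfun F := tofrac 'X.

Definition const (a : F) : ratfun F := tofrac a%:P.

Definition carlitz_t (c : ratfun F) : {poly (ratfun F)} :=
  tvar *: 'X + c *: 'X^#|F|.

(* rho_N = \sum_i N_i rho_t^i, powers being taken with respect to composition:
   the image of N under the only F-algebra homomorphism from F[t] to the
   F-linear polynomials sending t to carlitz_t c. *)
Definition carlitz (c : ratfun F) (N : {poly F}) : {poly (ratfun F)} :=
  \sum_(i < size N) const N`_i *: iter i (comp_poly (carlitz_t c)) 'X.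

Definition separable_closure (L : fieldType) (iota : {rmorphism ratfun F -> L})
    : Prop :=
  (forall x : L,
     exists2 p, separable_poly p & root (map_poly iota p) x)
  /\ (forall p : {poly L}, separable_poly p -> (1 < size p)%N ->
        exists x, root p x).

Section Representation.
Variables (L : fieldType) (iota : {rmorphism ratfun F -> L}).

Definition absolute_galois (sigma : {rmorphism L -> L}) : Prop :=
  bijective sigma /\ (forall a, sigma (iota a) = iota a).

(* sigma x = rho_a(x) on the N-torsion: the mod-N representation sends sigma to
   the class of a.  For N != 0 this determines a modulo N, since the torsion is
   free of rank one. *)
Definition mod_rep (c : ratfun F) (N : {poly F}) (sigma : {rmorphism L -> L})
    (a : {poly F}) : Prop :=
  forall x, root (map_poly iota (carlitz c N)) x ->
    sigma x = (map_poly iota (carlitz c a)).[x].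

(* N has to be monic and nonconstant: {poly %/ N} is F[X]/(X) otherwise. *)
Definition mod_rep_image (c : ratfun F) (N : {poly F})
    : {set {unit {poly %/ N}}} :=
  [set u | `[< exists2 sigma, absolute_galois sigma &
                 mod_rep c N sigma (val u : {poly %/ N}) >]].

Definition defect (c : ratfun F) (N : {poly F}) : nat :=
  #|[set: {unit {poly %/ N}}] : mod_rep_image c N|%g.

(* A unit of F[[t]] is given by its coefficients s, with s 0 != 0; its image in
   F[t]/(t^m) is its truncation. *)
Definition tadic_surjective (c : ratfun F) : Prop :=
  forall s : nat -> F, s 0%N != 0 ->
    exists2 sigma, absolute_galois sigma &
      forall m, (0 < m)%N -> mod_rep c 'X^m sigma (\poly_(i < m) s i).

End Representation.

Definition power_free (d : nat) (Delta : {poly F}) : Prop :=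
  Delta != 0 /\
  (forall pi : {poly F}, pi \is monic -> irreducible_poly pi ->
     ~~ (pi ^+ d %| Delta)).

Definition power_free_representative (d : nat) (c : ratfun F) (Delta : {poly F})
    : Prop :=
  power_free d Delta /\
  (exists2 y : ratfun F, y != 0 & tofrac Delta = c * y ^+ d).

Definition arboreal_poly (c : ratfun F) : {poly (ratfun F)} :=
  c *: 'X^(#|F|.-1) + tvar%:P.

Definition iter_poly (f : {poly (ratfun F)}) (n : nat) : {poly (ratfun F)} :=
  iter n (comp_poly f) 'X.

Definition galois_group_isog (f : {poly (ratfun F)}) (gT : finGroupType)
    (G : {set gT}) : Prop :=
  exists L : splittingFieldType (ratfun F),
    splittingFieldFor 1%AS (map_poly (in_alg L) f) {:L} /\
    'Gal({:L} / 1%AS)%g \isog G.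

End FunctionField.

(* The wreath product of A by B in its imprimitive action on X * Y. *)
Definition wreath (X Y : finType) (A : {set {perm X}}) (B : {set {perm Y}})
    : {set {perm X * Y}} :=
  [set s : {perm X * Y} | [exists b in B, exists phi : {ffun Y -> {perm X}},
     [forall y, phi y \in A] &&
     [forall x, forall y, s (x, y) == (phi y x, b y)]]].

Definition rotations (d : nat) : {set {perm 'Z_d}} :=
  [set perm (@addrI 'Z_d a) | a in 'Z_d].

Fixpoint tree_level (d n : nat) : finType :=
  if n is n'.+1 then ('Z_d * tree_level d n')%type : finType else unit.

(* The n-fold wreath product of C_d with itself, for 1 < d. *)
Fixpoint iter_wreath (d n : nat) : {set {perm tree_level d n}} :=
  match n with
  | 0 => [set: {perm unit}]
  | n'.+1 => wreath (rotations d) (iter_wreath d n')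
  end.

Definition first_level_maximal (F : finFieldType) (c : ratfun F) : Prop :=
  galois_group_isog (arboreal_poly c) (Zp #|F|.-1).

Definition arboreally_maximal (F : finFieldType) (c : ratfun F) : Prop :=
  forall n, (0 < n)%N ->
    galois_group_isog (iter_poly (arboreal_poly c) n) (iter_wreath #|F|.-1 n).

(* Main.v *)
Require Import Defs.
From HB Require Import structures.
From mathcomp Require Import all_boot all_order all_algebra all_fingroup.
From mathcomp Require Import all_solvable all_field.
From mathcomp Require Import boolp classical_sets.
From mathcomp Require Import zify.

Set Implicit Arguments.
Unset Strict Implicit.
Unset Printing Implicit Defensive.

Import GRing.Theory.
Local Open Scope ring_scope.

(** Put q = #|F|, d = q - 1 and rho_t(x) = t x + c x^q = x f_c(x).  Choose
    lam_0 a root of f_c and rho_t(lam_(m+1)) = lam_m.  Then lam_m is a root of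
    f_c o rho_t^m, of degree d q^m, and the theorem amounts to the
    irreducibility of this polynomial over K.  On the one hand
    f_c(lam_0) = 0 and f_c is irreducible of degree d when its splitting field,
    which is K(lam_0), has a Galois group of order d; so d divides
    [K(lam_m) : K].  On the other hand zeta_m = c lam_m^d satisfies zeta_0 = -t
    and zeta_m = zeta_(m+1) (t + zeta_(m+1))^d, a recursion in which c no longer
    occurs: zeta_m is a root of a monic Eisenstein polynomial at t, of degree
    q^m, so q^m divides [K(lam_m) : K] as well, and d is prime to q.

    For a unit s of F[[t]], lam_m |-> rho_s(lam_m) is then compatible with all
    polynomial relations over K, and it extends to an automorphism of the
    separable closure by Zorn's lemma. *)

(** * Extension of embeddings to the separable closure *)

(** An annihilator of least size works: the remainder of any other one modulo it also annihilates
    [x], hence vanishes. *)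
Lemma minimal_annihilator (K L : fieldType) (iota : {rmorphism K -> L}) (x : L)
    (p0 : {poly K}) : p0 != 0 -> root (map_poly iota p0) x ->
  exists p, [/\ irreducible_poly p, root (map_poly iota p) x
    & forall g, root (map_poly iota g) x -> p %| g].
Proof.
move=> p0n0 p0x.
pose Q n := `[< exists p : {poly K},
  [/\ p != 0, root (map_poly iota p) x & size p = n] >].
have exQ : exists n, Q n by exists (size p0); apply/asboolP; exists p0.
case: (ex_minnP exQ) => n /asboolP[p [pn0 px <-]] minp.
have minp' q : root (map_poly iota q) x -> q != 0 -> (size p <= size q)%N.
  by move=> qx qn0; apply: minp; apply/asboolP; exists q.
exists p; split=> //; first exact/(subfx_irreducibleP px pn0).
move=> g gx; rewrite -[_ %| _]/(g %% p == 0); apply: contraT => rn0.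
have rx : root (map_poly iota (g %% p)) x.
  move: gx; rewrite {1}(divp_eq g p) rmorphD rmorphM /= !rootE hornerD hornerM.
  by rewrite (eqP px) mulr0 add0r.
by have := minp' _ rx rn0; rewrite leqNgt ltn_modp pn0.
Qed.

Section PartialHom.
Variables (K L : fieldType) (iota : {rmorphism K -> L}).
Implicit Types (R : set (L * L)) (z : (L * L)%type).

(** Makes [L * L] a K-algebra. The graph of a partial homomorphism is a subalgebra of it, and
    evaluating a polynomial at a pair treats argument and image at once. *)
Definition diag (a : K) : (L * L)%type := (iota a, iota a).

Fact diag_is_zmod_morphism : zmod_morphism diag.
Proof. by move=> a b; rewrite /diag rmorphB. Qed.

Fact diag_is_monoid_morphism : monoid_morphism diag.
Proof. by split=> [|a b]; rewrite /diag ?rmorph1 ?rmorphM. Qed.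

HB.instance Definition _ :=
  GRing.isZmodMorphism.Build K (L * L)%type diag diag_is_zmod_morphism.
HB.instance Definition _ :=
  GRing.isMonoidMorphism.Build K (L * L)%type diag diag_is_monoid_morphism.

(* The graph of a K-algebra homomorphism from a subring of L to L. *)
Definition partial_hom R :=
  [/\ forall a, R (diag a), forall z w, R z -> R w -> R (z - w),
      forall z w, R z -> R w -> R (z * w) & forall y, R (0, y) -> y = 0].

Section Closure.
Variable R : set (L * L).
Hypothesis hR : partial_hom R.

Lemma partial_hom0 : R 0.
Proof. by case: hR => /(_ 0); rewrite /diag rmorph0. Qed.

Lemma partial_hom1 : R 1.
Proof. by case: hR => /(_ 1); rewrite /diag rmorph1. Qed.

Lemma partial_homD z w : R z -> R w -> R (z + w).
Proof.
case: hR => _ hB _ _ Rz Rw; rewrite -[w]opprK -[- w]sub0r.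
by apply: (hB) => //; apply: hB => //; apply: partial_hom0.
Qed.

Lemma partial_hom_inj z : R z -> z.1 = 0 -> z = 0.
Proof. by case: hR z => _ _ _ h [x y] /= Rz x0; move: Rz; rewrite x0 => /h->. Qed.

Definition coefs_in (G : {poly (L * L)}) := forall i, R G`_i.

Lemma coefs_inC z : R z -> coefs_in z%:P.
Proof. by move=> Rz i; rewrite coefC; case: eqP => // _; apply: partial_hom0. Qed.

Lemma coefs_inX : coefs_in 'X.
Proof.
move=> i; rewrite coefX.
by case: eqP => _; [apply: partial_hom1 | apply: partial_hom0].
Qed.

Lemma coefs_inB G H : coefs_in G -> coefs_in H -> coefs_in (G - H).
Proof. by case: hR => _ hB _ _ hG hH i; rewrite coefB; apply: hB. Qed.

Lemma coefs_inD G H : coefs_in G -> coefs_in H -> coefs_in (G + H).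
Proof. by move=> hG hH i; rewrite coefD; apply: partial_homD. Qed.

Lemma coefs_inM G H : coefs_in G -> coefs_in H -> coefs_in (G * H).
Proof.
case: hR => _ _ hM _ hG hH i; rewrite coefM.
apply: (big_ind R); [exact: partial_hom0 | exact: partial_homD |].
by move=> j _; apply: hM.
Qed.

Lemma coefs_in_map (p : {poly K}) : coefs_in (map_poly diag p).
Proof.
by case: hR => hd _ _ _ i; rewrite coef_map.
Qed.

Lemma coefs_in_horner G z : coefs_in G -> R z -> R G.[z].
Proof.
case: hR => _ _ hM _ hG Rz; rewrite horner_coef.
apply: (big_ind R); [exact: partial_hom0 | exact: partial_homD |] => i _.
apply: (hM) => //; elim: (i : nat) => [|n IHn].
  by rewrite expr0; apply: partial_hom1.
by rewrite exprS; apply: hM IHn.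
Qed.

(** Schoolbook division: [L * L] has zero divisors, but a monic divisor still allows cancelling the
    leading term of [G], and this never leaves the subring [R]. *)
Lemma coefs_in_divmod P : P \is monic -> coefs_in P -> forall G, coefs_in G ->
  exists Q S, [/\ coefs_in Q, coefs_in S, G = Q * P + S & (size S < size P)%N].
Proof.
move=> monP hP G; move: {2}(size G) (leqnn (size G)) => n.
elim: n G => [|n IHn] G.
  rewrite leqn0 size_poly_eq0 => /eqP-> _; exists 0, 0; split.
  - by apply: coefs_inC; apply: partial_hom0.
  - by apply: coefs_inC; apply: partial_hom0.
  - by rewrite mul0r addr0.
  by rewrite size_poly0 size_poly_gt0 monic_neq0.
move=> sG hG; case: (ltnP (size G) (size P)) => [lt|le].
  exists 0, G; split=> //; last by rewrite mul0r add0r.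
  by apply: coefs_inC; apply: partial_hom0.
pose H := (lead_coef G)%:P * 'X^(size G - size P).
have hH : coefs_in H.
  move=> i; rewrite coefCM coefXn; case: eqP => _.
    by rewrite mulr1; apply: hG.
  by rewrite mulr0; apply: partial_hom0.
have [||Q [S [hQ hS eqG ltS]]] := IHn (G - H * P).
- case: (posnP (size G)) => [/eqP|Gpos].
    rewrite size_poly_eq0 => /eqP G0.
    by rewrite /H G0 lead_coef0 !mul0r subrr size_poly0.
  have {}sG : ((size G).-1 <= n)%N by rewrite -ltnS prednK.
  apply: leq_trans sG; apply/leq_sizeP => j.
  rewrite leq_eqVlt => /orP[/eqP<-|ltj].
    rewrite coefB -mulrA coefCM coefXnM ltnNge.
    have -> : (size G - size P <= (size G).-1)%N.
      rewrite leq_subLR -{1}(prednK Gpos) -add1n leq_add2r.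
      by rewrite size_poly_gt0 monic_neq0.
    rewrite /=; have -> : ((size G).-1 - (size G - size P) = (size P).-1)%N.
      have Ppos : (0 < size P)%N by rewrite size_poly_gt0 monic_neq0.
      by rewrite -!subn1 subnAC subKn.
    by rewrite -[P`_ _]/(lead_coef P) (monicP monP) mulr1 -/(lead_coef G) subrr.
  have leGj : (size G <= j)%N by rewrite -(prednK Gpos).
  rewrite coefB (nth_default _ leGj) -mulrA coefCM coefXnM.
  case: ltnP => _; first by rewrite mulr0 subrr.
  rewrite nth_default ?mulr0 ?subrr //.
  by rewrite leq_subRL ?subnK // (leq_trans _ leGj) // leq_subr.
- by apply: coefs_inB => //; apply: coefs_inM.
exists (Q + H), S; split=> //; first exact: coefs_inD.
by rewrite mulrDl addrAC -eqG subrK.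
Qed.

Lemma map_diag_horner (p : {poly K}) z :
  (map_poly diag p).[z] = ((map_poly iota p).[z.1], (map_poly iota p).[z.2]).
Proof.
rewrite [LHS]surjective_pairing -(horner_map fst) -(horner_map snd) /=.
by rewrite -!map_poly_comp.
Qed.

(** The domain of [R] is a field: the minimal polynomial of [z.1] has a nonzero constant term, and
    it annihilates the whole pair [z] because [R] is single-valued. *)
Lemma partial_hom_inv z :
    (exists2 p : {poly K}, p != 0 & root (map_poly iota p) z.1) ->
  R z -> z.1 != 0 -> exists2 w, R w & w * z = 1.
Proof.
case=> p0 p0n0 p0x Rz zn0.
have [p [irr_p px _]] := minimal_annihilator p0n0 p0x.
have pz : (map_poly diag p).[z] = 0.
  apply: partial_hom_inj; last by rewrite map_diag_horner /= (eqP px).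
  by apply: coefs_in_horner => //; apply: coefs_in_map.
elim/poly_ind: p irr_p px pz => [|p c _] irr_p px pz.
  by have := irredp_neq0 irr_p; rewrite eqxx.
have cn0 : c != 0.
  apply: contra zn0 => /eqP c0; move: irr_p px; rewrite c0 addr0 => irr_p.
  have Xp : 'X %= p * 'X by apply: irr_p; rewrite ?size_polyX ?dvdp_mulIr.
  by rewrite -(eqp_map iota) map_polyX in Xp; rewrite -(eqp_root Xp) rootE hornerX.
have [hd hB hM _] := hR.
(* The minimal polynomial is now written p X + c, so p(z) z = -c. *)
exists (- diag c^-1 * (map_poly diag p).[z]).
  apply: (hM); last by apply: coefs_in_horner => //; apply: coefs_in_map.
  by rewrite -rmorphN; apply: hd.
move/eqP: pz; rewrite rmorphD rmorphM /= map_polyX map_polyC /= hornerD hornerMX.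
rewrite hornerC addr_eq0 => /eqP pz.
by rewrite -mulrA pz mulrNN -rmorphM mulVf // rmorph1.
Qed.

End Closure.

Hypothesis sep_alg : forall x : L,
  exists2 p, separable_poly p & root (map_poly iota p) x.
Hypothesis sep_closed : forall p : {poly L},
  separable_poly p -> (1 < size p)%N -> exists x, root p x.

(** A monic [P] over [R] of least size whose first projection kills [x] plays the role of the
    minimal polynomial of [x] over the domain of [R]. With [y] a root of its second projection, the
    subring [R'] generated by [R] and [(x, y)] is again a graph. *)
Lemma partial_hom_extend R x : partial_hom R ->
  exists R', [/\ partial_hom R', (R `<=` R')%classic & exists y, R' (x, y)].
Proof.
move=> hR; have [hd hB hM hinj] := hR.
have [p sep_p px] := sep_alg x.
have eval1 (G : {poly (L * L)%type}) (w : (L * L)%type) :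
    w.1 = x -> G.[w].1 = (map_poly fst G).[x].
  by move=> <-; rewrite -(horner_map fst).
pose Q n := `[< exists P,
  [/\ P \is monic, coefs_in R P, (map_poly fst P).[x] = 0 & size P = n] >].
have exQ : exists n, Q n.
  exists (size (map_poly diag ((lead_coef p)^-1 *: p))).
  apply/asboolP; exists (map_poly diag ((lead_coef p)^-1 *: p)); split=> //.
  - apply: monic_map; rewrite monicE lead_coefZ mulVf //.
    by rewrite lead_coef_eq0 separable_poly_neq0.
  - exact: coefs_in_map.
  - rewrite -map_poly_comp /= -[map_poly _ _]/(map_poly iota _) map_polyZ hornerZ.
    by rewrite (eqP px) mulr0.
case: (ex_minnP exQ) => n /asboolP[P [monP hP Px <-]] minP.
(* If the remainder modulo [P] were nonzero, its leading coefficient would be invertible in [R], and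
   rescaling would give a monic annihilator smaller than [P]. *)
have kerP G : coefs_in R G -> (map_poly fst G).[x] = 0 ->
    exists2 H, coefs_in R H & G = H * P.
  move=> hG Gx.
  have [H [S [hH hS eqG ltS]]] := coefs_in_divmod hR monP hP hG.
  have Sx : (map_poly fst S).[x] = 0.
    move: Gx; rewrite eqG rmorphD rmorphM /= hornerD hornerM Px mulr0 add0r.
    by [].
  suff S0 : S = 0 by exists H; rewrite // eqG S0 addr0.
  apply/eqP; apply: contraT => Sn0.
  have ln0 : (lead_coef S).1 != 0.
    apply: contra Sn0 => /eqP l0; rewrite -lead_coef_eq0; apply/eqP.
    by apply: (partial_hom_inj hR) l0; apply: hS.
  have [|w Rw wl] := partial_hom_inv hR _ (hS _) ln0.
    have [g sep_g gx] := sep_alg (lead_coef S).1.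
    by exists g => //; apply: separable_poly_neq0.
  have sn0 : (0 < size S)%N by rewrite size_poly_gt0.
  have wS1 : (w *: S)`_(size S).-1 = 1 by rewrite coefZ.
  have sz : size (w *: S) = size S.
    apply/eqP; rewrite eqn_leq size_scale_leq -(prednK sn0) ltnNge.
    apply/negP => /leq_sizeP/(_ _ (leqnn _)) /eqP.
    by rewrite wS1 oner_eq0.
  have : (size P <= size (w *: S))%N.
    apply: minP; apply/asboolP; exists (w *: S); split=> //.
    - by rewrite monicE lead_coefE sz wS1.
    - by rewrite -mul_polyC; apply: coefs_inM => //; apply: coefs_inC.
    by rewrite -mul_polyC rmorphM /= hornerM Sx mulr0.
  by rewrite sz leqNgt ltS.
have sP2 : size (map_poly snd P) = size P.
  by rewrite size_map_poly_id0 // (monicP monP) oner_eq0.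
have [||y Py] := sep_closed (p := map_poly snd P).
(* The second projection of [P] is separable because it divides the image of the separable
   polynomial [p]. *)
- have [||H hH eqp] := kerP (map_poly diag p).
  + exact: coefs_in_map.
  + by rewrite -map_poly_comp -[map_poly _ _]/(map_poly iota _) (eqP px).
  have /dvdp_separable : map_poly snd P %| map_poly iota p.
    have -> : map_poly iota p = map_poly snd (map_poly diag p).
      by rewrite -map_poly_comp.
    by rewrite eqp rmorphM /= dvdp_mull.
  by apply; rewrite separable_map.
- rewrite sP2 ltnNge; apply/negP => sP1.
  move: Px monP; rewrite (size1_polyC sP1) map_polyC hornerC monicE lead_coefC /=.
  by move=> P0 /eqP P1; move: P0; rewrite P1 => /eqP; rewrite oner_eq0.
pose R' := [set w | exists2 G, coefs_in R G & w = G.[(x, y)]]%classic.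
have Pxy : P.[(x, y)] = 0.
  rewrite [LHS]surjective_pairing -(horner_map fst) -(horner_map snd) /= Px.
  by rewrite (eqP Py).
exists R'; split.
- split.
  + move=> a; exists (diag a)%:P; last by rewrite hornerC.
    exact: coefs_inC.
  + move=> _ _ [G hG ->] [H hH ->]; exists (G - H); first exact: coefs_inB.
    by rewrite hornerD hornerN.
  + move=> _ _ [G hG ->] [H hH ->]; exists (G * H); first exact: coefs_inM.
    by rewrite hornerM.
  move=> z [G hG eqz].
  have [|H hH eqG] := kerP _ hG; first by rewrite -(eval1 _ (x, y) erefl) -eqz.
  by move: eqz; rewrite eqG hornerM Pxy mulr0 => -[].
- by move=> z Rz; exists z%:P; rewrite ?hornerC //; apply: coefs_inC.
by exists y; exists 'X; [apply: coefs_inX | rewrite hornerX].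
Qed.

(** The orbit of [x] under [sigma] stays among the finitely many roots of [p], so it repeats, and
    injectivity of [sigma] makes [x] itself periodic. *)
Lemma algebraic_endo_surj (sigma : {rmorphism L -> L}) :
  (forall a, sigma (iota a) = iota a) -> forall x, exists y, sigma y = x.
Proof.
move=> sigK x; have [p sep_p px] := sep_alg x.
(* [size p] is one more than the degree, so these iterates cannot all be distinct. *)
pose rs := mkseq (fun i => iter i sigma x) (size p).
have rsp : all (root (map_poly iota p)) rs.
  apply/allP => _ /mapP[i _ ->]; elim: i => //= i; rewrite !rootE => /eqP pi.
  rewrite -[map_poly iota p](_ : map_poly sigma (map_poly iota p) = _).
    by rewrite horner_map pi rmorph0.
  by rewrite -map_poly_comp; apply: eq_map_poly => a /=.
have : ~~ uniq rs.
  apply/negP => /(max_poly_roots _ rsp).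
  rewrite map_poly_eq0 separable_poly_neq0 // => /(_ isT).
  by rewrite size_map_poly size_mkseq ltnn.
case/(uniqPn 0) => i [j [ltij]]; rewrite size_mkseq => ltj.
rewrite !nth_mkseq ?(ltn_trans ltij) // -(subnK (ltnW ltij)) addnC iterD.
have inj_iter k : injective (iter k sigma).
  by elim: k => //= k IHk; apply: inj_comp IHk; apply: fmorph_inj.
move/inj_iter; rewrite -(prednK (_ : 0 < j - i)%N) ?subn_gt0 // iterS => zE.
by exists (iter (j - i).-1 sigma x).
Qed.

(** A maximal graph above [R0] is total by [partial_hom_extend], so it is the graph of a
    K-endomorphism, which is bijective by [algebraic_endo_surj]. *)
Lemma extend_to_automorphism R0 : partial_hom R0 ->
  exists2 sigma : {rmorphism L -> L},
    bijective sigma /\ (forall a, sigma (iota a) = iota a) &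
    forall z, R0 z -> sigma z.1 = z.2.
Proof.
move=> hR0.
(* set0 is allowed because Zorn_bigcup also asks for the empty chain. *)
pose good R := R = set0 \/ (partial_hom R /\ (R0 `<=` R)%classic).
have [|A [goodA maxA]] := @Zorn_bigcup _ good.
  move=> C goodC totC.
  have [[R [CR Rn0]]|noR] := pselect (exists R, C R /\ R <> set0); last first.
    left; apply/seteqP; split=> // z [R CR Rz].
    by case: noR; exists R; split=> // R0'; rewrite R0' in Rz.
  have goodR S z : C S -> S z -> partial_hom S /\ (R0 `<=` S)%classic.
    by move=> CS Sz; case: (goodC _ CS) => // S0; rewrite S0 in Sz.
  have [w Rw] : exists w, R w.
    apply: contrapT => noz; apply: Rn0; apply/seteqP; split=> // z Rz.
    by apply: noz; exists z.
  have [hR leR] := goodR _ _ CR Rw.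
  right; split; last by move=> z /leR Rz; exists R.
  have dir z z' :
      (\bigcup_(X in C) X)%classic z -> (\bigcup_(X in C) X)%classic z' ->
      exists S, [/\ C S, partial_hom S, S z & S z'].
    move=> [S CS Sz] [S' CS' Sz'].
    have [leS|leS] := totC _ _ CS CS'.
      by exists S'; split=> //; [case: (goodR _ _ CS' Sz') | apply: leS].
    by exists S; split=> //; [case: (goodR _ _ CS Sz) | apply: leS].
  split.
  - by move=> a; exists R => //; case: hR.
  - move=> z z' hz hz'; have [S [CS hS Sz Sz']] := dir _ _ hz hz'.
    by exists S => //; case: hS => _ h _ _; apply: h.
  - move=> z z' hz hz'; have [S [CS hS Sz Sz']] := dir _ _ hz hz'.
    by exists S => //; case: hS => _ _ h _; apply: h.
  - move=> y hy; have [S [CS [_ _ _ h] Sz _]] := dir _ _ hy hy.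
    exact: h.
have {goodA} [hA leA] : partial_hom A /\ (R0 `<=` A)%classic.
  case: goodA => // A0; case: (maxA R0); last by right; split.
  rewrite A0; split=> // R0sub; exact: (R0sub 0 (partial_hom0 hR0)).
have totA x : exists y, A (x, y).
  have [R' [hR' leR' [y Ry]]] := partial_hom_extend x hA.
  exists y; suff <- : R' = A by [].
  apply: contrapT => neq; apply: (maxA R'); last first.
    by right; split=> //; apply: subset_trans leA leR'.
  by split=> // leA'; apply: neq; apply/seteqP.
have [f fA] := choice totA.
have [hd hB hM hinj] := hA.
have fE x y : A (x, y) -> f x = y.
  move=> Axy; apply/subr0_eq/hinj; rewrite -[0](subrr x).
  exact: hB (fA x) Axy.
have fB : zmod_morphism f.
  by move=> x y; apply: fE; apply: (hB (x, f x) (y, f y)).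
have fM : monoid_morphism f.
  split; first by apply: fE; apply: partial_hom1 hA.
  by move=> x y; apply: fE; apply: (hM (x, f x) (y, f y)).
pose sigma : {rmorphism L -> L} :=
  HB.pack f (GRing.isZmodMorphism.Build L L f fB)
            (GRing.isMonoidMorphism.Build L L f fM).
have sigK a : sigma (iota a) = iota a by apply: fE; apply: hd.
exists sigma; last by move=> [x y] /leA /fE.
split=> //; have [g gK] := choice (algebraic_endo_surj sigK).
by exists g => // x; apply: (fmorph_inj sigma); rewrite gK.
Qed.

End PartialHom.

(** * Eisenstein's criterion at t *)

Lemma fraction_cross (R : idomainType) (x : {fraction R}) :
  exists2 d : R, d != 0 & exists n, tofrac d * x = tofrac n.
Proof.
elim/quotW: x => r; exists (\d_r)%R; first exact: denom_ratioP.
exists (\n_r)%R; unlock tofrac; rewrite -[LHS]FracField.pi_mul.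
apply/eqmodP; rewrite /= FracField.equivfE /FracField.mulf.
by rewrite !numden_Ratio ?mul1r ?mulr1 ?oner_eq0 ?denom_ratioP // mulrC.
Qed.

Lemma clear_denominators (R : idomainType) (p : {poly {fraction R}}) :
  exists2 d : R, d != 0 & exists P, tofrac d *: p = map_poly (@tofrac R) P.
Proof.
elim/poly_ind: p => [|p c [d dn0 [P dp]]].
  by exists 1; rewrite ?oner_eq0 //; exists 0; rewrite scaler0 rmorph0.
have [e en0 [n eqn]] := fraction_cross c.
exists (d * e); first exact: mulf_neq0.
exists (e *: P * 'X + (d * n)%:P).
rewrite [RHS]rmorphD [in RHS]rmorphM /= map_polyX map_polyC /= map_polyZ /= -dp.
rewrite !rmorphM /= -eqn scalerDr; congr (_ + _).
  by rewrite scalerA scalerAl [tofrac e * _]mulrC.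
by rewrite -[LHS]mul_polyC !polyCM mulrA.
Qed.

Section Eisenstein.
Variable F : fieldType.

Local Notation eval0 := (map_poly (horner_eval (0 : F))).

Lemma eval0_eq0 (G : {poly {poly F}}) : eval0 G = 0 -> exists H, G = 'X *: H.
Proof.
move=> G0; exists (map_poly (fun c : {poly F} => c %/ 'X) G).
apply/polyP => i; rewrite coefZ coef_map_id0 ?div0p //.
have : (G`_i).[0] = 0.
  by rewrite -[LHS]/(horner_eval 0 G`_i) -coef_map G0 coef0.
by move/eqP; rewrite -rootE -dvdp_XsubCl subr0 => /divpK; rewrite mulrC.
Qed.

(** Gauss's lemma at the prime t alone: if t divides [a], then Q R vanishes modulo t, so t divides
    one of the factors and cancels; the degree of [a] drops each time. *)
Lemma remove_X_content (P Q R : {poly {poly F}}) a : a != 0 ->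
  a *: P = Q * R -> exists b Q' R',
  [/\ b.[0] != 0, b *: P = Q' * R', size Q' = size Q & size R' = size R].
Proof.
move: {2}(size a) (leqnn (size a)) => n.
elim: n a Q R => [|n IHn] a Q R; first by rewrite leqn0 size_poly_eq0 => ->.
move=> sa an0 eqPQ; have [a0|a0] := eqVneq a.[0] 0; last by exists a, Q, R.
have Xn0 : 'X != 0 :> {poly F} by rewrite polyX_eq0.
have XCn0 : ('X : {poly F})%:P != 0 by rewrite polyC_eq0.
have [b eqa] : exists b, a = 'X * b.
  move/eqP: a0; rewrite -rootE -dvdp_XsubCl subr0 => /divpK ab.
  by exists (a %/ 'X); rewrite mulrC.
have bn0 : b != 0 by apply: contra an0; rewrite eqa => /eqP->; rewrite mulr0.
have sb : (size b <= n)%N.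
  by rewrite -ltnS; move: sa; rewrite eqa mulrC size_mulX.
have : eval0 Q * eval0 R = 0.
  rewrite -rmorphM -eqPQ eqa /= map_polyZ /= rmorphM /= /horner_eval hornerX.
  by rewrite mul0r scale0r.
move/eqP; rewrite mulf_eq0 => /orP[]/eqP/eval0_eq0[H eqH].
  have [|c [Q' [R' [c0 eqP' sQ sR]]]] := IHn b H R sb bn0.
    by apply: (mulfI XCn0); rewrite mulrA !mul_polyC scalerA -eqa eqPQ eqH.
  by exists c, Q', R'; split=> //; rewrite sQ eqH size_scale.
have [|c [Q' [R' [c0 eqP' sQ sR]]]] := IHn b Q H sb bn0.
  by apply: (mulfI XCn0); rewrite mulrCA !mul_polyC scalerA -eqa eqPQ eqH.
by exists c, Q', R'; split=> //; rewrite sR eqH size_scale.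
Qed.

(** Clearing denominators and powers of t turns a factorization over F(t) into b P = R' Q' with b(0)
    nonzero. Modulo t the product is b(0) X^n: either both constant terms vanish, and t^2 divides
    that of P, or one factor carries the full degree. *)
Lemma eisenstein_X (P : {poly {poly F}}) n : (0 < n)%N ->
  size P = n.+1 -> eval0 P = 'X^n -> ~~ ('X^2 %| P`_0) ->
  irreducible_poly (map_poly (@tofrac _) P).
Proof.
move=> n_gt0 sP P0 nXP.
have smap (G : {poly {poly F}}) : size (map_poly (@tofrac _) G) = size G.
  apply: size_map_inj_poly; rewrite ?tofrac0 // => x y /eqP.
  by rewrite tofrac_eq => /eqP.
have Pn0 : P != 0 by rewrite -size_poly_eq0 sP.
split; first by rewrite smap sP.
move=> q sq dq; rewrite -dvdp_size_eqp // smap sP.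
have [r eqr] := dvdpP _ _ dq.
have [d dn0 [Q eqQ]] := clear_denominators q.
have [e en0 [R eqR]] := clear_denominators r.
have dn0' : tofrac d != 0 by rewrite tofrac_eq0.
have en0' : tofrac e != 0 by rewrite tofrac_eq0.
have sQ : size Q = size q by rewrite -(smap Q) -eqQ (size_scale _ dn0').
have sR : size R = size r by rewrite -(smap R) -eqR (size_scale _ en0').
have PRQ : (d * e) *: P = R * Q.
  apply: (@map_inj_poly _ _ (@tofrac _)); rewrite ?tofrac0 //.
    by move=> x y /eqP; rewrite tofrac_eq => /eqP.
  rewrite map_polyZ /= (rmorphM (map_poly _)) /= -eqQ -eqR eqr tofracM.
  by rewrite -scalerAl -scalerAr scalerA [tofrac e * _]mulrC.
have [b [R' [Q' [b0 eqP' sR' sQ']]]] := remove_X_content (mulf_neq0 dn0 en0) PRQ.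
rewrite -sQ -sQ' in sq *.
have bn0 : b != 0 by apply: contra b0 => /eqP->; rewrite horner0.
have bPn0 : b *: P != 0 by rewrite -mul_polyC mulf_neq0 ?polyC_eq0.
have Qn0 : Q' != 0 by apply: contra bPn0; rewrite eqP' => /eqP->; rewrite mulr0.
have Rn0 : R' != 0 by apply: contra bPn0; rewrite eqP' => /eqP->; rewrite mul0r.
have sQR : (size R' + size Q' = n.+2)%N.
  have := congr1 (fun p : {poly {poly F}} => size p) eqP'.
  rewrite size_scale // sP size_mul // => ->.
  by rewrite prednK // addn_gt0 size_poly_gt0 Rn0.
have e0 : eval0 R' * eval0 Q' = b.[0] *: 'X^n.
  by rewrite -rmorphM -eqP' /= map_polyZ /= P0.
have le0 G : (size (eval0 G) <= size G)%N by apply: size_poly.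
(* A factor with nonzero constant term modulo t is prime to X, so X^n divides the other one. *)
have full A B : eval0 A * eval0 B = b.[0] *: 'X^n -> (eval0 A)`_0 != 0 ->
    (n < size B)%N.
  move=> eAB A0.
  have : 'X^n %| eval0 B.
    rewrite -(@Gauss_dvdpr _ _ (eval0 A)); last first.
      rewrite coprimep_sym; apply: coprimep_expr.
      by rewrite -['X]subr0 coprimep_XsubC rootE horner_coef0.
    by rewrite eAB dvdpZr.
  move/dvdp_leq => /(_ _)/leq_trans-/(_ _ _ (le0 _)).
  rewrite size_polyXn; apply.
  apply: contraTneq isT => B0; move/eqP: eAB; rewrite B0 mulr0 eq_sym.
  by rewrite scaler_eq0 (negPf b0) -size_poly_eq0 size_polyXn.
have [R0|R0] := eqVneq (eval0 R')`_0 0; last first.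
  by move: (full _ _ e0 R0) Rn0; rewrite -size_poly_gt0; lia.
have [Q0|Q0] := eqVneq (eval0 Q')`_0 0; last first.
  by move: (full _ _ (etrans (mulrC _ _) e0) Q0) Qn0 sq; rewrite -size_poly_gt0; lia.
have X_dvd (G : {poly {poly F}}) : (eval0 G)`_0 = 0 -> 'X %| G`_0.
  by rewrite coef_map /= /horner_eval -['X]subr0 dvdp_XsubCl rootE => ->.
case/negP: nXP.
have : 'X^2 %| b * P`_0.
  rewrite -coefZ eqP' coefM big_ord_recl big_ord0 addr0 subn0.
  by rewrite expr2 dvdp_mul // X_dvd.
rewrite Gauss_dvdpr //; apply: coprimep_expl.
by rewrite -['X]subr0 coprimep_sym coprimep_XsubC.
Qed.

End Eisenstein.

(** * Irreducibility along the t-power torsion tower *)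

Lemma size_comp_poly_succ (R : idomainType) (p q : {poly R}) m n :
  (0 < m)%N -> (0 < n)%N -> size p = m.+1 -> size q = n.+1 ->
  size (p \Po q) = (m * n).+1.
Proof.
move=> m0 n0 sp sq; have := size_comp_poly p q; rewrite sp sq /= => s1.
by rewrite -s1 prednK // lt0n; apply: contraTneq m0 => s0;
  move: s1 n0; rewrite s0 /=; case: m {sp} => // m; case: n {sq}.
Qed.

Section Tower.
Variable F : finFieldType.
Local Notation K := (ratfun F).
Local Notation q := #|F|.
Local Notation d := (#|F|.-1).

(* The m-th iterate of Z |-> Z (t + Z)^d. *)
Fixpoint zeta_iter (m : nat) : {poly {poly F}} :=
  if m is m'.+1 then zeta_iter m' * (zeta_iter m' + 'X%:P) ^+ d else 'X.

(** Its roots are the Z whose m-th image is -t, the value of c x^d at a root x of f_c. *)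
Definition zeta_poly m := zeta_iter m + 'X%:P.

Lemma q_gt1 : (1 < q)%N. Proof. exact: finNzRing_gt1. Qed.

Lemma size_zeta_iter m : size (zeta_iter m) = (q ^ m).+1.
Proof.
elim: m => [|m IHm] /=; first by rewrite size_polyX.
have qm : (0 < q ^ m)%N by rewrite expn_gt0 ltnW ?q_gt1.
have s1 : size (zeta_iter m + 'X%:P) = (q ^ m).+1.
  by rewrite size_polyDl // IHm size_polyC polyX_eq0.
have n1 : zeta_iter m + 'X%:P != 0 by rewrite -size_poly_eq0 s1.
have n2 := expf_neq0 d n1.
have := size_exp (zeta_iter m + 'X%:P) d; rewrite s1 /= => sE.
have sE' : size ((zeta_iter m + 'X%:P) ^+ d) = (q ^ m * d).+1.
  by rewrite -sE prednK // size_poly_gt0.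
rewrite size_mul // -?size_poly_eq0 IHm // sE' addSn addnS /=.
by rewrite -mulnS prednK ?(ltnW q_gt1) // expnSr.
Qed.

Lemma size_zeta_poly m : size (zeta_poly m) = (q ^ m).+1.
Proof.
have qm : (0 < q ^ m)%N by rewrite expn_gt0 ltnW ?q_gt1.
by rewrite size_polyDl size_zeta_iter // size_polyC polyX_eq0.
Qed.

(** Modulo t the map Z |-> Z (t + Z)^d becomes Z |-> Z^q, so only Z^(q^m) survives; [zeta_iter m]
    has no constant term, which leaves exactly t. *)
Lemma zeta_poly_irreducible m :
  irreducible_poly (map_poly (@tofrac _) (zeta_poly m)).
Proof.
have qm : (0 < q ^ m)%N by rewrite expn_gt0 ltnW ?q_gt1.
apply: (eisenstein_X qm (size_zeta_poly m)).
  have t0 : map_poly (horner_eval (0 : F)) ('X)%:P = 0.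
    by rewrite map_polyC /= /horner_eval hornerX.
  rewrite rmorphD /= t0 addr0.
  elim: m {qm} => [|m IHm] /=; first by rewrite map_polyX.
  rewrite rmorphM rmorphXn rmorphD /= t0 addr0.
  by rewrite IHm -exprS prednK ?(ltnW q_gt1) // -exprM expnSr.
have -> : (zeta_poly m)`_0 = 'X.
  rewrite coefD coefC /=; suff -> : (zeta_iter m)`_0 = 0 by rewrite add0r.
  elim: m {qm} => [|m IHm] /=; first by rewrite coefX.
  by rewrite coef0M IHm mul0r.
by apply/negP => /dvdp_leq; rewrite polyX_eq0 size_polyXn size_polyX => /(_ isT).
Qed.

Section Operator.
Variables (c : K) (E : fieldType) (j : {rmorphism K -> E}).

Definition carlitz_op (x : E) : E := j (tvar F) * x + j c * x ^+ q.

Lemma horner_carlitz_t x : (map_poly j (carlitz_t c)).[x] = carlitz_op x.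
Proof.
by rewrite rmorphD /= !map_polyZ /= map_polyX map_polyXn !hornerE.
Qed.

Lemma horner_arboreal x :
  (map_poly j (arboreal_poly c)).[x] = j c * x ^+ d + j (tvar F).
Proof.
by rewrite rmorphD /= map_polyZ /= map_polyXn map_polyC !hornerE.
Qed.

Lemma carlitz_opE x : carlitz_op x = x * (map_poly j (arboreal_poly c)).[x].
Proof.
rewrite horner_arboreal mulrDr addrC mulrC; congr (_ + _).
by rewrite -[q in LHS](prednK (ltnW q_gt1)) exprS mulrCA.
Qed.

Lemma zeta_root x m : root (map_poly j (arboreal_poly c)) (iter m carlitz_op x) ->
  root (map_poly j (map_poly (@tofrac _) (zeta_poly m))) (j c * x ^+ d).
Proof.
rewrite rootE horner_arboreal => /eqP x0.
(* The map y |-> c y^d intertwines rho_t with Z |-> Z (t + Z)^d, because rho_t(y) = y f_c(y) and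
   f_c(y) = t + c y^d. *)
have zE n y : (map_poly j (map_poly (@tofrac _) (zeta_iter n))).[j c * y ^+ d] =
    j c * (iter n carlitz_op y) ^+ d.
  elim: n => [|n IHn] /=; first by rewrite !map_polyX hornerX.
  rewrite !rmorphM !rmorphXn !rmorphD /= hornerM IHn horner_exp hornerD IHn.
  rewrite !map_polyC hornerC /= -/(tvar F) carlitz_opE horner_arboreal.
  by rewrite exprMn mulrA.
by rewrite rootE !rmorphD /= !map_polyC /= hornerD zE hornerC x0.
Qed.

End Operator.

(** Up to a constant, [f] is the minimal polynomial of [x]; the tower law concludes. *)
Lemma irreducible_dvd_dim (M : fieldExtType K) (f : {poly K}) (x : M) :
  irreducible_poly f -> root (map_poly (in_alg M) f) x ->
  ((size f).-1 %| \dim {:M})%N.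
Proof.
move=> irr_f fx.
have /polyOver1P[g eqg] := minPolyOver 1%AS x.
have g_f : g %| f.
  rewrite -(dvdp_map (in_alg M)) -eqg; apply: minPoly_dvdp => //.
  by apply/polyOver1P; exists f.
have sg : size g = (adjoin_degree 1%AS x).+1.
  by rewrite -size_minPoly eqg size_map_poly.
have g1 : size g != 1.
  by rewrite sg.
have /eqp_size <- := irr_f.2 _ g1 g_f.
rewrite sg /= -[adjoin_degree _ _]muln1.
rewrite -[1%N in X in (X %| _)%N](dimv1 M) -dim_Fadjoin.
by apply: field_dimS; apply: subvf.
Qed.

Lemma size_carlitz_t (c : K) : c != 0 -> size (carlitz_t c) = q.+1.
Proof.
move=> c0; have s1 : size (c *: 'X^q) = q.+1.
  by rewrite (size_scale _ c0) size_polyXn.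
rewrite /carlitz_t addrC size_polyDl s1 // ltnS.
by apply: leq_trans (size_scale_leq _ _) _; rewrite size_polyX q_gt1.
Qed.

Lemma size_arboreal (c : K) : c != 0 -> size (arboreal_poly c) = q.
Proof.
move=> c0; have d0 : (0 < d)%N by rewrite -ltnS prednK ?q_gt1 // ltnW ?q_gt1.
have s1 : size (c *: 'X^d) = q.
  by rewrite (size_scale _ c0) size_polyXn prednK ?(ltnW q_gt1).
rewrite /arboreal_poly size_polyDl s1 //.
exact: leq_ltn_trans (size_polyC_leq1 _) q_gt1.
Qed.

Lemma tvar_neq0 : tvar F != 0.
Proof. by rewrite tofrac_eq0 polyX_eq0. Qed.

Definition carlitz_iter (c : K) m := iter m (comp_poly (carlitz_t c)) 'X.

Lemma horner_carlitz_iter (c : K) (E : fieldType) (j : {rmorphism K -> E}) m x :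
  (map_poly j (carlitz_iter c m)).[x] = iter m (carlitz_op c j) x.
Proof.
rewrite /carlitz_iter; elim: m x => [|m IHm] x /=.
  by rewrite map_polyX hornerX.
by rewrite map_comp_poly horner_comp horner_carlitz_t IHm -iterSr.
Qed.

Lemma size_carlitz_iter (c : K) m : c != 0 -> size (carlitz_iter c m) = (q ^ m).+1.
Proof.
move=> c0; rewrite /carlitz_iter; elim: m => [|m IHm] /=.
  by rewrite size_polyX.
rewrite (size_comp_poly_succ _ _ IHm (size_carlitz_t c0)) ?expn_gt0 -?expnSr //;
  by rewrite ltnW ?q_gt1.
Qed.

Definition level_poly (c : K) m := arboreal_poly c \Po carlitz_iter c m.

Lemma horner_level (c : K) (E : fieldType) (j : {rmorphism K -> E}) m x :
  (map_poly j (level_poly c m)).[x] =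
  (map_poly j (arboreal_poly c)).[iter m (carlitz_op c j) x].
Proof. by rewrite map_comp_poly horner_comp horner_carlitz_iter. Qed.

Lemma size_level_poly (c : K) m : c != 0 -> size (level_poly c m) = (d * q ^ m).+1.
Proof.
have q0 := ltnW q_gt1; move=> c0.
apply: size_comp_poly_succ (size_carlitz_iter m c0); rewrite ?expn_gt0 ?q0 //.
  by rewrite -ltnS prednK // q_gt1.
by rewrite size_arboreal // prednK.
Qed.

(** In K[X]/(p), with x the class of X, rho_t^m(x) is a root of f_c and c x^d is a root of
    [zeta_poly m]. Hence the coprime numbers d and q^m both divide deg p, and [p] has the full
    degree d q^m. *)
Lemma irreducible_factor_level (c : K) m (p : {poly K}) : c != 0 ->
  irreducible_poly (arboreal_poly c) -> irreducible_poly p ->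
  p %| level_poly c m -> p %= level_poly c m.
Proof.
move=> c0 irr_f irr_p p_dvd.
rewrite -dvdp_size_eqp // eqn_leq dvdp_leq //=; last first.
  by rewrite -size_poly_eq0 size_level_poly.
have [M dimM [x px _]] := irredp_FAdjoin irr_p.
have {p_dvd} fx : root (map_poly (in_alg M) (arboreal_poly c))
    (iter m (carlitz_op c (in_alg M)) x).
  rewrite rootE -horner_level -rootE.
  by case/dvdpP: p_dvd => r ->; rewrite rmorphM rootM px orbT.
have dvd_q := irreducible_dvd_dim (zeta_poly_irreducible m) (zeta_root fx).
have dvd_d := irreducible_dvd_dim irr_f fx.
rewrite size_arboreal // dimM in dvd_d.
rewrite size_map_inj_poly ?tofrac0 // in dvd_q; last first.
  by move=> a b /eqP; rewrite tofrac_eq => /eqP.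
rewrite size_zeta_poly dimM /= in dvd_q.
have co : coprime d (q ^ m).
  by rewrite coprimeXr // -[q in X in coprime _ X](prednK (ltnW q_gt1)) coprimenS.
have p_gt1 := irr_p.1.
rewrite size_level_poly // -[size p]prednK ?(ltnW p_gt1) // ltnS dvdn_leq //.
  by rewrite -ltnS prednK // ltnW.
by rewrite Gauss_dvd // dvd_d.
Qed.

End Tower.

(** * The first arboreal level *)

Lemma separable_from_bezout (E : fieldType) (p u v : {poly E}) (e : E) :
  e != 0 -> u * p + v * p^`() = e%:P -> separable_poly p.
Proof.
move=> e0 bez; rewrite unlock; apply/Bezout_coprimepP; exists (u, v) => /=.
by rewrite bez -alg_polyC; apply: eqp_scale.
Qed.

Section FirstLevel.
Variable F : finFieldType.
Local Notation K := (ratfun F).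
Local Notation q := #|F|.
Local Notation d := (#|F|.-1).

(** The quotient y / z is a root of X^q - X, which is the product of all X - a with a in F. *)
Lemma eq_up_to_constant (E : fieldType) (j : {rmorphism K -> E}) (y z : E) :
  z != 0 -> y ^+ d = z ^+ d -> exists a, y = j (const a) * z.
Proof.
move=> z0 yz; pose w := y / z.
have wq : w ^+ q = w.
  rewrite -[q](prednK (ltnW (q_gt1 F))) exprS /w expr_div_n yz divff ?mulr1 //.
  exact: expf_neq0.
have : root (map_poly (j \o (@tofrac _ \o polyC)) ('X^q - 'X)) w.
  by rewrite rmorphB /= map_polyXn map_polyX rootE !hornerE wq subrr.
rewrite finField_genPoly rmorph_prod /= /root horner_prod prodf_seq_eq0.
case/hasP => a _; rewrite /= map_polyXsubC hornerXsubC subr_eq0 => /eqP wa.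
by exists a; rewrite /const -[j _]wa divfK.
Qed.

Lemma natr_card_eq0 : q%:R = 0 :> K.
Proof.
have q0 : q%:R = 0 :> F.
  have := @expg_cardG F [set: F]%G 1%R (finset.in_setT _).
  by rewrite FinRing.zmodXgE cardsT; apply.
by rewrite -(rmorph_nat (@tofrac _ \o @polyC F)) q0 rmorph0.
Qed.

Lemma natr_card_pred : d%:R = -1 :> K.
Proof.
apply/eqP; rewrite -addr_eq0 -[1]/(1%:R) -natrD addn1 prednK ?(ltnW (q_gt1 F)) //.
by rewrite natr_card_eq0.
Qed.

(** Since d = -1 in K, X f_c' = - c X^d, and therefore f_c + X f_c' = t is a Bezout relation. *)
Lemma separable_arboreal (c : K) : separable_poly (arboreal_poly c).
Proof.
apply: (@separable_from_bezout _ _ 1 'X _ (tvar_neq0 F)).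
have d0 : (0 < d)%N by rewrite -ltnS prednK ?q_gt1 // ltnW ?q_gt1.
have -> : 'X * (arboreal_poly c)^`() = - (c *: 'X^d).
  rewrite derivD derivC addr0 derivZ derivXn -scalerAr mulrnAr -exprS prednK //.
  by rewrite -[_ *+ d]scaler_nat natr_card_pred scaleN1r scalerN.
by rewrite mul1r addrAC subrr add0r.
Qed.

(** Formulated for sets because [iter_wreath] carries no group structure; [isog] supplies a map from
    A minus 1 onto B minus 1. *)
Lemma isog_leq_card (gT hT : finGroupType) (A : {set gT}) (B : {set hT}) :
  1%g \in A -> A \isog B -> (#|B| <= #|A|)%N.
Proof.
move=> A1 /existsP[f /andP[_ /eqP eqfA]].
rewrite [#|A|](cardsD1 1%g) A1 (cardsD1 1%g B).
by apply: leq_add; rewrite ?leq_b1 // -eqfA leq_imset_card.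
Qed.

(** All roots of f_c are constant multiples of one root z, so the splitting field is K(z) and its
    degree is the order of the Galois group. The bound on [G] then forces the minimal polynomial of
    z to have degree d. A lower bound on [G] serves both the cyclic group and the wreath product. *)
Lemma irreducible_arboreal (c : K) (gT : finGroupType) (G : {set gT}) :
  c != 0 -> (d <= #|G|)%N -> galois_group_isog (arboreal_poly c) G ->
  irreducible_poly (arboreal_poly c).
Proof.
move=> c0 dG [L [[rs f_rs gen_rs] isoG]].
set f := arboreal_poly c in f_rs *; pose fL := map_poly (in_alg L) f.
have sf : size f = q by apply: size_arboreal.
have sfL : size fL = q by rewrite size_map_poly.
have d0 : (0 < d)%N by rewrite -ltnS prednK ?q_gt1 // ltnW ?q_gt1.
have cL0 : in_alg L c != 0 by rewrite fmorph_eq0.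
have rootfE x : root fL x -> x ^+ d = - in_alg L (tvar F) / in_alg L c.
  rewrite rootE horner_arboreal addr_eq0 => /eqP eqx.
  by rewrite -eqx mulrAC divff // mul1r.
have rs_root x : x \in rs -> root fL x.
  by rewrite -root_prod_XsubC (eqp_root f_rs).
have [z zrs] : exists z, z \in rs.
  case: rs f_rs {gen_rs rs_root} => [|z rs _]; last by exists z; apply: mem_head.
  rewrite big_nil => /eqp_size; rewrite -/fL sfL size_poly1 => q1.
  by have := q_gt1 F; rewrite q1.
have fz := rs_root _ zrs.
have z0 : z != 0.
  apply/eqP => z0; move: fz; rewrite z0 rootE horner_arboreal expr0n.
  by rewrite (gtn_eqF d0) mulr0 add0r fmorph_eq0 (negPf (tvar_neq0 F)).
have genz : {:L}%VS = <<1; z>>%VS.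
  apply/eqP; rewrite eqEsubv subvf andbT -gen_rs.
  apply/Fadjoin_seqP; split; first exact: subv_adjoin.
  move=> y /rs_root fy.
  have [|a ->] := @eq_up_to_constant _ (in_alg L) y z z0.
    by rewrite !rootfE.
  by rewrite rpredM ?memv_adjoin // subvP_adjoin // rpredZ ?rpred1.
have galL : galois 1%AS {:L}%AS.
  apply/splitting_galoisField; exists fL; split.
  - by apply/polyOver1P; exists f.
  - by rewrite separable_map; apply: separable_arboreal.
  by exists rs.
have dimL : (d <= \dim {:L})%N.
  rewrite -(divn1 (\dim _)) -[X in (_ %/ X)%N](dimv1 L) (galois_dim galL).
  apply: leq_trans dG _; apply: isog_leq_card isoG; exact: group1.
have size_min : (q <= size (minPoly 1 z))%N.
  rewrite size_minPoly -[q](prednK (ltnW (q_gt1 F))) ltnS.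
  by rewrite -[adjoin_degree _ _]muln1 -[X in (_ * X)%N](dimv1 L) -dim_Fadjoin -genz.
have min_fL : minPoly 1 z %= fL.
  rewrite -dvdp_size_eqp; last first.
    by apply: minPoly_dvdp fz; apply/polyOver1P; exists f.
  rewrite eqn_leq sfL size_min andbT -sfL dvdp_leq //.
    by rewrite -size_poly_eq0 sfL -lt0n ltnW ?q_gt1.
  by apply: minPoly_dvdp fz; apply/polyOver1P; exists f.
split; first by rewrite sf q_gt1.
move=> h sh hf; rewrite -(eqp_map (in_alg L)) -/fL.
have hmin : map_poly (in_alg L) h %| minPoly 1 z.
  by rewrite (eqp_dvdr _ min_fL) dvdp_map.
have hover : map_poly (in_alg L) h \is a polyOver 1%AS.
  by apply/polyOver1P; exists h.
have /orP[h1|/eqp_size] := minPoly_irr hover hmin.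
  exact: eqp_trans h1 min_fL.
by rewrite size_poly1 size_map_poly => /eqP; rewrite (negPf sh).
Qed.

(** The substitution X |-> X / y carries the twisted polynomial back to f_c and preserves degrees of
    factors. *)
Lemma irreducible_arboreal_twist (c y : K) : c != 0 -> y != 0 ->
  irreducible_poly (arboreal_poly c) ->
  irreducible_poly (arboreal_poly (c * y ^+ d)).
Proof.
move=> c0 y0 irr_f; have cy0 : c * y ^+ d != 0 := mulf_neq0 c0 (expf_neq0 d y0).
have fE : arboreal_poly (c * y ^+ d) \Po (y^-1 *: 'X) = arboreal_poly c.
  rewrite comp_polyD comp_polyZ comp_Xn_poly comp_polyC exprZn scalerA exprVn.
  by rewrite -mulrA (mulfV (expf_neq0 d y0)) mulr1.
split; first by rewrite size_arboreal // q_gt1.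
move=> h sh /dvdpP[r eqf]; have sX : size (y^-1 *: 'X) = 2.
  by rewrite (size_scale _ (invr_neq0 y0)) size_polyX.
have /eqp_size : h \Po (y^-1 *: 'X) %= arboreal_poly c.
  apply: irr_f.2; first by rewrite size_comp_poly2.
  by rewrite -fE eqf rmorphM /= dvdp_mulIr.
rewrite size_comp_poly2 // => s_h; rewrite -dvdp_size_eqp.
  by rewrite s_h !size_arboreal.
by rewrite eqf dvdp_mulIr.
Qed.

Hypothesis hq : odd q.

(** Oddness excludes q = 2, where d = 1 while ['Z_d] still has two elements. *)
Lemma d_gt1 : (1 < d)%N.
Proof. by move: hq (q_gt1 F); case: (#|F|) => [|[|[|]]]. Qed.

Lemma card_iter_wreath1 : (d <= #|iter_wreath d 1|)%N.
Proof.
have injT (a : 'Z_d) : injective (fun z : 'Z_d * unit => (a + z.1, z.2)).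
  by move=> [x []] [x' []] /(congr1 fst) /= /(@addrI 'Z_d a) ->.
pose rot a := perm (injT a).
have inj_rot : injective rot.
  move=> a b /permP/(_ (0, tt)); rewrite !permE => /(congr1 fst) /=.
  by rewrite !addr0.
have d1 := d_gt1.
rewrite -[X in (X <= _)%N](Zp_cast d1) -[X in (X <= _)%N]card_ord.
rewrite -(card_imset predT inj_rot); apply/subset_leq_card/fintype.subsetP.
move=> _ /imsetP[a _ ->]; rewrite inE; apply/existsP; exists 1%g.
rewrite finset.in_setT /=; apply/existsP; exists [ffun _ => perm (@addrI 'Z_d a)].
apply/andP; split; apply/forallP => x.
  by rewrite ffunE; apply/imsetP; exists a.
by apply/forallP => u; rewrite !permE ffunE permE.
Qed.

Lemma first_level_irreducible (c : K) : c != 0 -> first_level_maximal c ->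
  irreducible_poly (arboreal_poly c).
Proof.
move=> c0; apply: irreducible_arboreal => //.
by rewrite card_Zp // ltnW // d_gt1.
Qed.

Lemma arboreal_irreducible (c : K) : c != 0 -> arboreally_maximal c ->
  irreducible_poly (arboreal_poly c).
Proof.
move=> c0 /(_ 1%N isT); rewrite /iter_poly /= comp_polyX.
exact: irreducible_arboreal card_iter_wreath1.
Qed.

End FirstLevel.

(** * The t-adic representation *)

Section Torsion.
Variable F : finFieldType.
Local Notation K := (ratfun F).
Local Notation q := #|F|.
Local Notation d := (#|F|.-1).
Variables (L : fieldType) (iota : {rmorphism K -> L}) (c : K).
Hypothesis c0 : c != 0.
Local Notation T := (carlitz_op c iota).
Local Notation k a := (iota (const a)).

(** The additive group of F is an elementary abelian p-group, so q is a power of p, and p is also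
    the characteristic of L. *)
Lemma exprDq (x y : L) : (x + y) ^+ q = x ^+ q + y ^+ q.
Proof.
have [p _ charp] := finPcharP F.
have charL : p \in [pchar L].
  exact: (rmorph_pchar (iota \o (@tofrac _ \o @polyC F))).
rewrite exprDn_pchar // (eq_pnat _ (pcharf_eq charL)).
have := abelem_pgroup (fin_ring_pchar_abelem charp).
by rewrite /pgroup cardsT.
Qed.

Lemma carlitz_opD : {morph T : x y / x + y}.
Proof. by move=> x y; rewrite /carlitz_op exprDq !mulrDr addrACA. Qed.

Lemma carlitz_op0 : T 0 = 0.
Proof. by rewrite /carlitz_op expr0n (gtn_eqF (ltnW (q_gt1 F))) !mulr0 addr0. Qed.

Lemma carlitz_opZ a x : T (k a * x) = k a * T x.
Proof.
rewrite /carlitz_op exprMn -rmorphXn /= /const -!rmorphXn /= expf_card.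
by rewrite mulrDr !(mulrCA (iota _) (iota (tofrac a%:P))).
Qed.

Lemma carlitz_opB x y : T (x - y) = T x - T y.
Proof. by apply/eqP; rewrite eq_sym subr_eq -carlitz_opD subrK. Qed.

Lemma iter_carlitz_opD n : {morph iter n T : x y / x + y}.
Proof. by elim: n => // n IHn x y /=; rewrite IHn carlitz_opD. Qed.

Lemma iter_carlitz_op0 n : iter n T 0 = 0.
Proof. by elim: n => //= n ->; rewrite carlitz_op0. Qed.

Lemma iter_carlitz_opZ n a x : iter n T (k a * x) = k a * iter n T x.
Proof. by elim: n => //= n ->; rewrite carlitz_opZ. Qed.

Definition rho (N : {poly F}) x := (map_poly iota (carlitz c N)).[x].

(** The free bound [n] lets two polynomials be expanded over the same range. *)
Lemma rhoE n (N : {poly F}) x : (size N <= n)%N ->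
  rho N x = \sum_(i < n) k N`_i * iter i T x.
Proof.
move=> leNn; rewrite /rho /carlitz rmorph_sum /= horner_sum.
have termE (i : 'I_(size N)) : (map_poly iota (const N`_i *: carlitz_iter c i)).[x] =
    k N`_i * iter i T x.
  by rewrite map_polyZ hornerZ horner_carlitz_iter.
rewrite (eq_bigr _ (fun i _ => termE i)).
rewrite (big_ord_widen n (fun i => k N`_i * iter i T x) leNn) big_mkcond /=.
apply: eq_bigr => i _; case: ltnP => // leNi.
by rewrite (nth_default _ leNi) /const !rmorph0 mul0r.
Qed.

Lemma rhoD N N' x : rho (N + N') x = rho N x + rho N' x.
Proof.
pose n := maxn (size N) (size N').
rewrite !(@rhoE n) ?leq_maxl ?leq_maxr ?size_polyD // -big_split /=.
by apply: eq_bigr => i _; rewrite coefD /const !rmorphD mulrDl.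
Qed.

Lemma rho_addr N : {morph rho N : x y / x + y}.
Proof.
move=> x y; rewrite !(rhoE _ (leqnn _)) -big_split /=.
by apply: eq_bigr => i _; rewrite iter_carlitz_opD mulrDr.
Qed.

Lemma rho_0 N : rho N 0 = 0.
Proof.
rewrite (rhoE _ (leqnn _)) big1 // => i _.
by rewrite iter_carlitz_op0 mulr0.
Qed.

Lemma rho_scale N a x : rho N (k a * x) = k a * rho N x.
Proof.
rewrite !(rhoE _ (leqnn _)) big_distrr /=.
by apply: eq_bigr => i _; rewrite iter_carlitz_opZ mulrCA.
Qed.

Lemma rho_iter N n x : rho N (iter n T x) = iter n T (rho N x).
Proof.
rewrite !(rhoE _ (leqnn _)).
rewrite (big_morph _ (iter_carlitz_opD n) (iter_carlitz_op0 n)).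
by apply: eq_bigr => i _; rewrite iter_carlitz_opZ -!iterD addnC.
Qed.

(** [rho N] is F-linear and commutes with [T], hence with every F-combination of iterates of [T]. *)
Lemma rhoC N N' x : rho N (rho N' x) = rho N' (rho N x).
Proof.
rewrite [rho N' x](rhoE _ (leqnn _)) [RHS](rhoE _ (leqnn _)).
rewrite (big_morph _ (rho_addr N) (rho_0 N)).
by apply: eq_bigr => i _; rewrite rho_scale rho_iter.
Qed.

Lemma rho_monomial a n x : rho (a%:P * 'X^n) x = k a * iter n T x.
Proof.
rewrite (@rhoE n.+1); last first.
  by apply/leq_sizeP => j ltj; rewrite coefCM coefXn gtn_eqF // mulr0.
rewrite big_ord_recr big1 /= => [|i _].
  by rewrite coefCM coefXn eqxx mulr1 add0r.
by rewrite coefCM coefXn ltn_eqF // mulr0 /const !rmorph0 mul0r.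
Qed.

Lemma rho_Xn n x : rho 'X^n x = iter n T x.
Proof. by rewrite -['X^n]mul1r -[1]/(1%:P) rho_monomial /const !rmorph1 mul1r. Qed.

Lemma rho_fix (sigma : {rmorphism L -> L}) : (forall a, sigma (iota a) = iota a) ->
  forall N x, sigma (rho N x) = rho N (sigma x).
Proof.
move=> sigK N x; rewrite /rho -horner_map -map_poly_comp; congr (_.[_]).
exact: eq_map_poly.
Qed.

Hypothesis irr : irreducible_poly (arboreal_poly c).
Hypothesis hL : separable_closure iota.

Lemma deriv_carlitz_t : (carlitz_t c)^`() = (tvar F)%:P.
Proof.
have mulrn_card (p : {poly K}) : p *+ q = 0.
  by rewrite -scaler_nat natr_card_eq0 scale0r.
rewrite /carlitz_t derivD (derivZ (tvar F)) (derivZ c) derivX derivXn mulrn_card.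
rewrite [c *: 0]scaler0 addr0.
exact: alg_polyC.
Qed.

(** As q = 0 in K, the derivative of rho_t(X) - x is the nonzero constant t, so this polynomial is
    separable and has a root. *)
Lemma carlitz_op_surj x : exists y, T y = x.
Proof.
have [_ closedL] := hL.
pose p := map_poly iota (carlitz_t c) - x%:P.
have sp : size p = q.+1.
  rewrite /p size_polyDl size_map_poly size_carlitz_t // size_polyN.
  by apply: leq_ltn_trans (size_polyC_leq1 _) _; rewrite ltnS ltnW // q_gt1.
have [||y] := closedL p.
- apply: (@separable_from_bezout _ _ 0 1 (iota (tvar F))).
    by rewrite fmorph_eq0 tvar_neq0.
  rewrite mul0r add0r mul1r derivB derivC subr0 deriv_map deriv_carlitz_t.
  by rewrite map_polyC.
- by rewrite sp ltnS ltnW ?q_gt1.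
rewrite rootE /p hornerD hornerN hornerC horner_carlitz_t subr_eq0 => /eqP.
by exists y.
Qed.

Lemma carlitz_op_eq0 x y : root (map_poly iota (arboreal_poly c)) x -> T y = 0 ->
  exists a, y = k a * x.
Proof.
move=> fx; rewrite carlitz_opE => /eqP; rewrite mulf_eq0 => /orP[/eqP->|].
  by exists 0; rewrite /const !rmorph0 mul0r.
move=> /eqP fy; apply: (@eq_up_to_constant _ _ iota).
  apply: contraTneq fx => ->; rewrite rootE horner_arboreal expr0n.
  have d0 : (0 < d)%N by rewrite -ltnS prednK ?q_gt1 // ltnW ?q_gt1.
  by rewrite (gtn_eqF d0) mulr0 add0r fmorph_eq0 tvar_neq0.
have c0L : iota c != 0 by rewrite fmorph_eq0.
apply: (mulfI c0L); apply: (addIr (iota (tvar F))).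
by rewrite -!horner_arboreal fy (eqP fx).
Qed.

Lemma torsion_tower : exists lam : nat -> L,
  root (map_poly iota (arboreal_poly c)) (lam 0%N) /\ forall m, T (lam m.+1) = lam m.
Proof.
have [_ closedL] := hL.
have [||x fx] := closedL (map_poly iota (arboreal_poly c)).
- by rewrite separable_map; apply: separable_arboreal.
- by rewrite size_map_poly size_arboreal // q_gt1.
have [g gK] := choice carlitz_op_surj.
by exists (fun m => iter m g x); split=> // m; rewrite /= gK.
Qed.

Lemma irreducible_tadic_surjective : tadic_surjective iota c.
Proof.
move=> s s0; have [lam [lam0 lamS]] := torsion_tower.
have [sep_alg closedL] := hL.
have iter_lam n m : iter n T (lam (n + m)%N) = lam m.
  by elim: n => [|n IHn] //; rewrite iterSr addSn lamS.
have iter_lam0 m : iter m T (lam m) = lam 0%N by rewrite -{2}[m]addn0 iter_lam.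
have T_lam0 : T (lam 0%N) = 0 by rewrite carlitz_opE (eqP lam0) mulr0.
(* [lam m] is killed by rho_t^(m+1), so the coefficients of s up to index m determine rho_s(lam m),
   which is [mu m]. *)
pose N m := \poly_(i < m) s i; pose mu m := rho (N m.+1) (lam m).
have NS m : N m.+1 = N m + (s m)%:P * 'X^m.
  by rewrite /N !poly_def big_ord_recr /= mul_polyC.
have muS m : T (mu m.+1) = mu m.
  rewrite /mu -[T _]/(iter 1 T _) -rho_iter /= lamS NS rhoD rho_monomial.
  by rewrite iterS iter_lam0 T_lam0 mulr0 addr0.
have iter_mu n m : iter n T (mu (n + m)%N) = mu m.
  by elim: n => [|n IHn] //; rewrite iterSr addSn muS.
have mu0 : mu 0%N = k (s 0%N) * lam 0%N.
  by rewrite /mu NS /N poly_def big_ord0 add0r rho_monomial.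
(* A polynomial in [u m] is one in [u m'] after composition with rho_t^(m'-m); any two elements of
   [R0] thus live at a common level. *)
have tower (u : nat -> L) : (forall n m, iter n T (u (n + m)%N) = u m) ->
    forall m m' g, (m <= m')%N ->
    (map_poly iota g).[u m] = (map_poly iota (g \Po carlitz_iter c (m' - m))).[u m'].
  move=> hu m m' g lem; rewrite map_comp_poly horner_comp horner_carlitz_iter.
  by rewrite -{2}(subnK lem) hu.
pose R0 : set (L * L) := [set z | exists m g,
  z = ((map_poly iota g).[lam m], (map_poly iota g).[mu m])]%classic.
have hR0 : partial_hom iota R0.
  have dir z w : R0 z -> R0 w -> exists m g h,
      z = ((map_poly iota g).[lam m], (map_poly iota g).[mu m]) /\
      w = ((map_poly iota h).[lam m], (map_poly iota h).[mu m]).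
    move=> [m [g ->]] [n [h ->]]; exists (maxn m n).
    exists (g \Po carlitz_iter c (maxn m n - m)).
    exists (h \Po carlitz_iter c (maxn m n - n)).
    rewrite -!(tower lam iter_lam) ?leq_maxl ?leq_maxr //.
    by rewrite -!(tower mu iter_mu) ?leq_maxl ?leq_maxr.
  split.
  - by move=> a; exists 0%N, a%:P; rewrite map_polyC !hornerC.
  - move=> z w Rz Rw; have [m [g [h [-> ->]]]] := dir z w Rz Rw.
    by exists m, (g - h); rewrite rmorphB !hornerD !hornerN.
  - move=> z w Rz Rw; have [m [g [h [-> ->]]]] := dir z w Rz Rw.
    by exists m, (g * h); rewrite rmorphM !hornerM.
  move=> y [m [g [glam ->]]].
  have level_lam : root (map_poly iota (level_poly c m)) (lam m).
    by rewrite rootE horner_level iter_lam0.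
  (* rho_t^m sends [mu m] to s_0 lam_0, again a root of f_c because s_0^d = 1. As [level_poly c m]
     is the minimal polynomial of [lam m] up to a constant, [R0] is single-valued. *)
  have level_mu : root (map_poly iota (level_poly c m)) (mu m).
    rewrite rootE horner_level -{2}[m]addn0 iter_mu mu0 horner_arboreal.
    have s0d : s 0%N ^+ d = 1.
      apply: (mulfI s0); rewrite mulr1 -exprS prednK ?(ltnW (q_gt1 F)) //.
      exact: expf_card.
    rewrite exprMn -rmorphXn /= /const -!rmorphXn /= s0d !rmorph1 mul1r.
    by rewrite -horner_arboreal -rootE.
  have lvl0 : level_poly c m != 0 by rewrite -size_poly_eq0 size_level_poly.
  have [p [irr_p _ min_p]] := minimal_annihilator lvl0 level_lam.
  have p_lvl : p %= level_poly c m.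
    by apply: irreducible_factor_level => //; apply: min_p.
  have : level_poly c m %| g.
    by rewrite -(eqp_dvdl _ p_lvl); apply: min_p; rewrite rootE -glam.
  by case/dvdpP => h ->; rewrite rmorphM hornerM (eqP level_mu) mulr0.
have [sigma [bij_sigma sigK] sigR0] := extend_to_automorphism sep_alg closedL hR0.
have sig_lam m : sigma (lam m) = mu m.
  apply: (sigR0 (lam m, mu m)); exists m, 'X.
  by rewrite map_polyX !hornerX.
(* [lam m] generates the t^(m+1)-torsion, so knowing [sigma] on it suffices. In the induction, T x =
   rho_b(lam m) leaves x - rho_b(lam (m+1)) in the kernel of [T], the F-line of lam_0 =
   rho_t^(m+1)(lam (m+1)). *)
have torsion m x : iter m.+1 T x = 0 -> exists b, x = rho b (lam m).
  elim: m x => [|m IHm] x Tx.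
    have [a ->] := carlitz_op_eq0 lam0 Tx.
    by exists (a%:P * 'X^0); rewrite rho_monomial.
  have [b] := IHm (T x) (etrans (esym (iterSr _ _ _)) Tx).
  rewrite -lamS -[T (lam _)]/(iter 1 T _) rho_iter /= => eqTx.
  have [|a eqx] := @carlitz_op_eq0 _ (x - rho b (lam m.+1)) lam0.
    by rewrite carlitz_opB eqTx subrr.
  exists (b + a%:P * 'X^(m.+1)).
  by rewrite rhoD rho_monomial iter_lam0 -eqx addrC subrK.
exists sigma => // -[//|m] _ x.
rewrite rootE -/(rho _ _) rho_Xn => /eqP/torsion[b ->].
by rewrite (rho_fix sigK) sig_lam /mu rhoC.
Qed.

End Torsion.

(** A unit modulo t^m lifts to the power series with the same coefficients, padded with zeros; its
    constant term is nonzero because a unit is prime to t. *)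
Lemma tadic_surjective_defect (F : finFieldType) (L : fieldType)
    (iota : {rmorphism ratfun F -> L}) (c : ratfun F) m : (0 < m)%N ->
  tadic_surjective iota c -> defect iota c 'X^m = 1%N.
Proof.
move=> m0 surj; rewrite /defect (_ : mod_rep_image _ _ _ = [set: _]).
  by rewrite indexgg.
apply/setP => u; rewrite !inE; apply/asboolP.
pose p : {poly F} := val u.
(* The quotient is taken modulo [mk_monic 'X^m], which is ['X^m] itself only because m > 0. *)
have mkX : mk_monic ('X^m : {poly F}) = 'X^m by rewrite -(prednK m0) mk_monic_Xn.
have su : (size p <= m)%N.
  by apply: leq_trans (size_npoly _) _; rewrite mkX size_polyXn.
have [|sigma gal_sigma rep] := surj (fun i => p`_i).
  have := qpoly_intro_unit (mulVr (valP u)).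
  rewrite -/p mkX coprimep_pexpl //.
  by rewrite coprimep_sym -['X]subr0 coprimep_XsubC rootE horner_coef0.
exists sigma => //; suff -> : polyn (val u) = \poly_(i < m) p`_i by apply: rep.
apply/polyP => i; rewrite coef_poly; case: ltnP => // lei.
by rewrite nth_default // (leq_trans su).
Qed.

Theorem theorem3 (F : finFieldType) (hq : odd #|F|)
    (c : ratfun F) (hc : c != 0)
    (Ksep : fieldType) (iota : {rmorphism ratfun F -> Ksep})
    (hKsep : separable_closure iota) :
  (first_level_maximal c ->
     tadic_surjective iota c /\
     (forall Delta : {poly F}, power_free_representative #|F|.-1 c Delta ->
        forall m : nat, (1 <= m)%N -> defect iota (tofrac Delta) 'X^m = 1%N))
  /\ (arboreally_maximal c -> tadic_surjective iota c).
Proof.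
split=> [/(first_level_irreducible hq hc) irr|/(arboreal_irreducible hq hc) irr].
  split=> [|Delta [_ [y y0 eqD]] m m0]; first exact: irreducible_tadic_surjective.
  apply: (tadic_surjective_defect m0); rewrite eqD.
  apply: (irreducible_tadic_surjective (mulf_neq0 hc (expf_neq0 _ y0)) _ hKsep).
  exact: irreducible_arboreal_twist.
exact: irreducible_tadic_surjective.
Qed.
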